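(* Let $\Gamma$ be a positive affine semigroup. The minimal size of a lift of $\Gamma$ equals the nonnegative integer rank of the slack matrix of $\Gamma$.
   Context: $\mathbb{Z}_+$ and $\mathbb{R}_+$ denote the nonnegative integers and nonnegative reals. An affine semigroup is a set $\Gamma=\{\sum_{i=1}^k m_iv_i \mid m_i\in\mathbb{Z}_+\}\subseteq\mathbb{R}^n$, for some $v_1,\dots,v_k\in\mathbb{R}^n$, such that $\Lambda_\Gamma=\{x-y\mid x,y\in\Gamma\}$ is a lattice (a discrete additive subgroup of $\mathbb{R}^n$). It is positive if $0$ is the only $x\in\Gamma$ with $-x\in\Gamma$. A positive affine semigroup has a unique minimal generating set. The dual of $\Gamma$ is $\Gamma^*=\{w\in\operatorname{span}(\Gamma)\mid \langle w,a\rangle\in\mathbb{Z}_+\text{ for all }a\in\Gamma\}$; equivalently $\Gamma^*=\Lambda_\Gamma^*\cap K_\Gamma^*$, where $\Lambda_\Gamma^*=\{w\in\operatorname{span}(\Lambda_\Gamma)\mid\langle w,v\rangle\in\mathbb{Z}\ \forall v\in\Lambda_\Gamma\}$, $K_\Gamma$ is the convex cone generated by $\Gamma$ and $K_\Gamma^*$ is its dual cone. It is identified with the set $\operatorname{Hom}(\Gamma,\mathbb{Z}_+)$ of semigroup homomorphisms. For positive $\Gamma$, $\Gamma^*$ is again a positive affine semigroup. Slack matrix: if $a_1,\dots,a_k$ and $b_1,\dots,b_l$ are the minimal generating sets of $\Gamma$ and $\Gamma^*$, the slack matrix of $\Gamma$ is the matrix in $\mathbb{Z}_+^{k\times l}$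 with $(i,j)$-entry $\langle a_i,b_j\rangle$ (unique up to row and column permutations). Lift: a lift of a positive affine semigroup $\Gamma$ is another positive affine semigroup $\widetilde\Gamma$ (possibly in a different ambient space) together with a semigroup homomorphism $\iota:\Gamma\to\widetilde\Gamma$ such that the adjoint map $\iota^*$, determined by $\langle a,\iota^*(y)\rangle=\langle\iota(a),y\rangle$ for all $a\in\Gamma$, $y\in\widetilde\Gamma^*$ (that is, precomposition with $\iota$), satisfies $\iota^*(\widetilde\Gamma^* )=\Gamma^*$. The size of the lift is the number of elements of the minimal generating set of $\widetilde\Gamma$. Nonnegative integer rank: for a nonnegative integer matrix $A$, its nonnegative integer rank is the smallest inner dimension $k$ of a factorization $A=B^\top C$ with $B$ and $C$ nonnegative integer matrices having $k$ rows each. *)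

(* Defs.v *)
From HB Require Import structures.
From mathcomp Require Import all_boot all_order all_algebra.
From mathcomp Require Import all_classical all_reals all_analysis.

Set Implicit Arguments.
Unset Strict Implicit.
Unset Printing Implicit Defensive.

Import Order.TTheory GRing.Theory Num.Theory.
Import numFieldNormedType.Exports.

Local Open Scope classical_set_scope.
Local Open Scope ring_scope.

Section AffineSemigroups.
Context {R : realType}.

Definition dot {n} (x y : 'rV[R]_n) : R := \sum_(j < n) x 0 j * y 0 j.

Definition nat_span {n k} (v : 'I_k -> 'rV[R]_n) : set 'rV[R]_n :=
  [set x | exists m : 'I_k -> nat, x = \sum_(i < k) v i *+ m i].

Definition difference_group {n} (G : set 'rV[R]_n) : set 'rV[R]_n :=
  [set z | exists x y, [/\ G x, G y & z = x - y]].

Definition affine_semigroup {n} (G : set 'rV[R]_n) : Prop :=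
  (exists (k : nat) (v : 'I_k -> 'rV[R]_n), G = nat_span v) /\
  difference_group G `<=` isolated (difference_group G).

Definition positive_affine_semigroup {n} (G : set 'rV[R]_n) : Prop :=
  affine_semigroup G /\ (forall x, G x -> G (- x) -> x = 0).

(* [a] enumerates, without repetition, a generating set of [G] none of whose
   proper subsets generates [G]. *)
Definition minimal_generators {n k} (G : set 'rV[R]_n)
    (a : 'I_k -> 'rV[R]_n) : Prop :=
  [/\ injective a,
      nat_span a = G &
      forall (l : nat) (b : 'I_l -> 'rV[R]_n),
        nat_span b = G -> range b `<=` range a -> range b = range a].

Definition real_span {n} (G : set 'rV[R]_n) : set 'rV[R]_n :=
  [set w | exists s : seq 'rV[R]_n,
     (forall v, v \in s -> G v) /\ w \in << s >>%VS].

Definition dual {n} (G : set 'rV[R]_n) : set 'rV[R]_n :=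
  [set w | real_span G w /\ forall a, G a -> dot w a \is a Num.nat].

(* The slack matrix is determined only up to permutations of its rows and
   columns, hence a predicate. *)
Definition slack_matrix {n k l} (G : set 'rV[R]_n) (S : 'M[nat]_(k, l)) : Prop :=
  exists (a : 'I_k -> 'rV[R]_n) (b : 'I_l -> 'rV[R]_n),
    [/\ minimal_generators G a,
        minimal_generators (dual G) b &
        forall i j, (S i j)%:R = dot (a i) (b j)].

(* A map G -> G' is represented by a total function on the ambient space, of
   which only the values on G are constrained.  Preservation of 0 follows from
   additivity. *)
Definition semigroup_hom {n m} (G : set 'rV[R]_n) (G' : set 'rV[R]_m)
    (iota : 'rV[R]_n -> 'rV[R]_m) : Prop :=
  (forall x, G x -> G' (iota x)) /\
  (forall x y, G x -> G y -> iota (x + y) = iota x + iota y).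

(* The values of [iota_adj] on [dual G'] are determined by this condition,
   because an element of [real_span G] is determined by its pairings with G. *)
Definition adjoint_map {n m} (G : set 'rV[R]_n) (G' : set 'rV[R]_m)
    (iota : 'rV[R]_n -> 'rV[R]_m) (iota_adj : 'rV[R]_m -> 'rV[R]_n) : Prop :=
  forall y, dual G' y ->
    dual G (iota_adj y) /\
    (forall a, G a -> dot a (iota_adj y) = dot (iota a) y).

Definition is_lift {n m} (G : set 'rV[R]_n) (G' : set 'rV[R]_m)
    (iota : 'rV[R]_n -> 'rV[R]_m) : Prop :=
  [/\ positive_affine_semigroup G',
      semigroup_hom G G' iota &
      exists iota_adj : 'rV[R]_m -> 'rV[R]_n,
        adjoint_map G G' iota iota_adj /\ iota_adj @` dual G' = dual G].

Definition has_lift_of_size {n} (G : set 'rV[R]_n) (r : nat) : Prop :=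
  exists (m : nat) (G' : set 'rV[R]_m) (iota : 'rV[R]_n -> 'rV[R]_m),
    is_lift G G' iota /\
    exists g : 'I_r -> 'rV[R]_m, minimal_generators G' g.

End AffineSemigroups.

Section NonnegativeIntegerRank.
Context {k l : nat}.

Definition nat_factorization (A : 'M[nat]_(k, l)) (r : nat) : Prop :=
  exists (B : 'M[nat]_(r, k)) (C : 'M[nat]_(r, l)), A = B^T *m C.

Lemma nat_factorization_ex (A : 'M[nat]_(k, l)) :
  exists r, `[< nat_factorization A r >].
Proof.
by exists k; apply/asboolP; exists 1%:M, A; rewrite trmx1 mul1mx.
Qed.

Definition nonneg_int_rank (A : 'M[nat]_(k, l)) : nat :=
  ex_minn (nat_factorization_ex A).

End NonnegativeIntegerRank.

(* Main.v *)
Require Import Defs.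
From HB Require Import structures.
From mathcomp Require Import all_boot all_order all_algebra.
From mathcomp Require Import all_classical all_reals all_analysis.

(** Every lift of [G] of size [r] yields a factorization of the slack matrix of
    inner dimension [r]: expand the images of the generators of [G] in the
    generators of the lift, and pair these with preimages of the generators of
    the dual.  Conversely, given [S = B^T C], the semigroup generated by the
    rows of [C] in [Z_+^l] is a lift of [G] via [a |-> (<a, b_j>)_j]; it has at
    most [r] minimal generators, and if [r] is the rank, then exactly [r] by the
    first part. *)

Import Order.TTheory GRing.Theory Num.Theory.
Import numFieldNormedType.Exports.

Section Lifts.
Set Implicit Arguments.
Unset Strict Implicit.
Unset Printing Implicit Defensive.
Local Open Scope classical_set_scope.
Local Open Scope ring_scope.
Context {R : realType}.

(** * The inner product and real spans *)

Lemma mulrn_mxE m n (A : 'M[R]_(m, n)) c i j : (A *+ c) i j = A i j *+ c.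
Proof. by rewrite -scaler_nat mxE mulr_natl. Qed.

Lemma int_norm_lt1 (x : R) : x \is a Num.int -> `|x| < 1 -> x = 0.
Proof. by move=> /intrP[m ->]; rewrite -intr_norm ltrz1; case: m => [[]|]. Qed.

Lemma dotE n (x y : 'rV[R]_n) : dot x y = (x *m y^T) 0 0.
Proof. by rewrite mxE; apply: eq_bigr => j _; rewrite mxE. Qed.

Lemma dotC n (x y : 'rV[R]_n) : dot x y = dot y x.
Proof. by apply: eq_bigr => j _; rewrite mulrC. Qed.

Lemma dotDl n (x y z : 'rV[R]_n) : dot (x + y) z = dot x z + dot y z.
Proof. by rewrite !dotE mulmxDl mxE. Qed.

Lemma dotZl n c (x z : 'rV[R]_n) : dot (c *: x) z = c * dot x z.
Proof. by rewrite !dotE -scalemxAl mxE. Qed.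

Lemma dotBl n (x y z : 'rV[R]_n) : dot (x - y) z = dot x z - dot y z.
Proof. by rewrite dotDl -scaleN1r dotZl mulN1r. Qed.

Lemma dot_suml n I (s : seq I) (F : I -> 'rV[R]_n) z :
  dot (\sum_(i <- s) F i) z = \sum_(i <- s) dot (F i) z.
Proof.
by rewrite dotE mulmx_suml summxE; apply: eq_bigr => i _; rewrite dotE.
Qed.

Lemma dot_mulmx n m (x : 'rV[R]_n) (y : 'rV[R]_m) (M : 'M[R]_(m, n)) :
  dot x (y *m M) = dot (x *m M^T) y.
Proof. by rewrite !dotE trmx_mul mulmxA. Qed.

Lemma dot_row n m (x : 'rV[R]_n) (M : 'M[R]_(m, n)) i :
  dot x (row i M) = (x *m M^T) 0 i.
Proof. by rewrite mxE; apply: eq_bigr => j _; rewrite !mxE. Qed.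

Lemma dot_eq0 n (x : 'rV[R]_n) : (dot x x == 0) = (x == 0).
Proof.
apply/eqP/eqP => [/eqP|->]; last by rewrite dotE mul0mx mxE.
rewrite psumr_eq0 => [/allP x0|j _]; last by rewrite -expr2 sqr_ge0.
apply/rowP => j; have := x0 j (mem_index_enum j).
by rewrite mulf_eq0 orbb mxE => /eqP.
Qed.

Lemma real_span_dot0 n (G : set 'rV[R]_n) w z : real_span G w ->
  (forall a, G a -> dot a z = 0) -> dot w z = 0.
Proof.
move=> [s [sG ws]] Gz0; rewrite (coord_span (X := in_tuple s) ws).
rewrite dot_suml big1// => i _.
by rewrite dotZl Gz0 ?mulr0//; apply/sG/mem_nth.
Qed.

Lemma real_spanD n (G : set 'rV[R]_n) x y :
  real_span G x -> real_span G y -> real_span G (x + y).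
Proof.
move=> [s [sG xs]] [t [tG yt]]; exists (s ++ t); split.
  by move=> v; rewrite mem_cat => /orP[/sG|/tG].
by rewrite span_cat memv_add.
Qed.

Lemma real_spanZ n (G : set 'rV[R]_n) c x :
  real_span G x -> real_span G (c *: x).
Proof. by move=> [s [sG xs]]; exists s; split => //; rewrite memvZ. Qed.

Lemma real_span_sum n (G : set 'rV[R]_n) I (s : seq I) (F : I -> 'rV[R]_n) :
  (forall i, real_span G (F i)) -> real_span G (\sum_(i <- s) F i).
Proof.
move=> FG; elim/big_ind: _ => //; last exact: real_spanD.
by exists [::]; split => //; exact: mem0v.
Qed.

(** The difference [x - y] is orthogonal to [G], hence to the whole span of [G], hence to itself. *)
Lemma real_span_inj n (G : set 'rV[R]_n) x y :
  real_span G x -> real_span G y ->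
  (forall a, G a -> dot a x = dot a y) -> x = y.
Proof.
move=> Gx Gy xy; apply/eqP; rewrite -subr_eq0 -dot_eq0; apply/eqP.
apply: (@real_span_dot0 _ G) => [|a Ga].
  by apply: real_spanD => //; rewrite -scaleN1r; exact: real_spanZ.
by rewrite dotC dotBl dotC xy// dotC subrr.
Qed.

(** * Generating families over the nonnegative integers *)

Lemma nat_span_gen n k (v : 'I_k -> 'rV[R]_n) i : nat_span v (v i).
Proof.
exists (fun j => (j == i) : nat).
rewrite (bigD1 i)//= eqxx mulr1n big1 ?addr0// => j /negPf ->.
by rewrite mulr0n.
Qed.

Lemma nat_spanS n k l (v : 'I_k -> 'rV[R]_n) (w : 'I_l -> 'rV[R]_n) :
  range v `<=` range w -> nat_span v `<=` nat_span w.
Proof.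
move=> vw.
have /choice[f fE] : forall i, exists j, w j = v i.
  by move=> i; have [|j _ <-] := vw (v i); [exists i | exists j].
(* [f] may identify several indices, so coefficients are added up over its fibres. *)
move=> _ [m ->]; exists (fun j => \sum_(i | f i == j) m i)%N.
rewrite (partition_big f predT)//=; apply: eq_bigr => j _.
by rewrite -sumrMnr; apply: eq_bigr => i /eqP <-; rewrite fE.
Qed.

(** A generating family of least possible length is both injective and irredundant, and its length
    is at most that of [v]. *)
Lemma minimal_generators_ex n k (v : 'I_k -> 'rV[R]_n) :
  exists2 r, (r <= k)%N & exists g : 'I_r -> 'rV[R]_n,
    minimal_generators (nat_span v) g.
Proof.
pose P r := `[< exists g : 'I_r -> 'rV[R]_n, nat_span g = nat_span v >].
have exP : exists r, P r by exists k; apply/asboolP; exists v.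
case: (ex_minnP exP) => r /asboolP[g gv] rmin.
(* Deleting repetitions from [b] leaves a generating family, so [b] has at least [r] distinct
   values. *)
have size_gen l (b : 'I_l -> 'rV[R]_n) :
    nat_span b = nat_span v -> (r <= size (undup (codom b)))%N.
  move=> bv; apply: rmin; apply/asboolP.
  pose c := tnth (in_tuple (undup (codom b))); exists c.
  rewrite -bv; apply/seteqP; split; apply: nat_spanS.
    move=> _ [i _ <-]; have /codomP[j ->] : c i \in codom b.
      by rewrite -mem_undup; exact: mem_tnth.
    by exists j.
  move=> _ [i _ <-].
  have /(tnthP (in_tuple _))[j ->] : b i \in undup (codom b).
    by rewrite mem_undup codom_f.
  by exists j.
exists r; first by apply: rmin; apply/asboolP; exists v.
exists g; split => //.
- apply/injectiveP; rewrite -[X in is_true X]/(uniq (codom g)).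
  rewrite -[uniq _]negbK -ltn_size_undup -leqNgt size_codom card_ord.
  exact: size_gen.
- move=> l b bv bg; apply/seteqP; split => // _ [i _ <-].
  (* Pigeonhole: at least [r] distinct values inside the range of [g], which has at most [r], fill
     that range. *)
  have sub : {subset undup (codom b) <= codom g}.
    move=> x; rewrite mem_undup => /codomP[j ->].
    by have [|p _ <-] := bg (b j); [exists j | exact: codom_f].
  have [|_ eqg] := uniq_min_size (undup_uniq (codom b)) sub.
    by rewrite size_codom card_ord size_gen.
  have : g i \in undup (codom b) by rewrite eqg codom_f.
  by rewrite mem_undup => /codomP[j ->]; exists j.
Qed.

(** * From lifts to factorizations *)

Lemma lift_nat_factorization n m (G : set 'rV[R]_n) (G' : set 'rV[R]_m) iota
    k l (S : 'M[nat]_(k, l)) r (g : 'I_r -> 'rV[R]_m) :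
  slack_matrix G S -> is_lift G G' iota -> nat_span g = G' ->
  nat_factorization S r.
Proof.
move=> [a [b [[_ aG _] [_ bG _] Sab]]] [_ [iotaG _] [adj [adjP adjG]]] gG'.
have /choice[c cE] : forall i, exists c : 'I_r -> nat,
    iota (a i) = \sum_p g p *+ c p.
  move=> i; suff : nat_span g (iota (a i)) by case=> c; exists c.
  by rewrite gG'; apply: iotaG; rewrite -aG; exact: nat_span_gen.
have /choice[y yP] : forall j, exists y, dual G' y /\ adj y = b j.
  move=> j; suff : (adj @` dual G') (b j) by case=> y; exists y.
  by rewrite adjG -bG; exact: nat_span_gen.
have /choice[d dE] : forall pj : 'I_r * 'I_l, exists q : nat,
    dot (g pj.1) (y pj.2) = q%:R.
  move=> [p j]; have [[_ yG'] _] := yP j.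
  by rewrite dotC; apply/natrP/yG'; rewrite -gG'; exact: nat_span_gen.
(* With [adj (y j) = b j], the entry is <a_i, b_j> = <iota(a_i), y_j> = sum_p c_ip <g_p, y_j>. *)
exists (\matrix_(p, i) c i p), (\matrix_(p, j) d (p, j)).
apply/matrixP => i j; apply/eqP; rewrite -(eqr_nat R) Sab.
have [yG' <-] := yP j; have [_ ->] := adjP _ yG'; last first.
  by rewrite -aG; exact: nat_span_gen.
rewrite cE dot_suml mxE natr_sum; apply/eqP/eq_bigr => p _.
by rewrite !mxE natrM -(dE (p, j)) -scaler_nat dotZl.
Qed.

(** * From factorizations to lifts *)

Lemma submx_mul_tr m n (A : 'M[R]_(m, n)) : (A^T <= A *m A^T)%MS.
Proof.
(* If v A A^T = 0, then |vA|^2 = 0 and so vA = 0. Equal left kernels give equal ranks, and the row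
   space of A A^T always lies in that of A^T. *)
suff kerA : (kermx (A *m A^T) <= kermx A)%MS.
  rewrite -(geq_leqif (mxrank_leqif_sup (submxMl A A^T))) mxrank_tr.
  have := mxrankS kerA; rewrite !mxrank_ker.
  by rewrite leq_sub2lE ?rank_leq_row.
apply/row_subP => i; apply/sub_kermxP.
set v := row i _; apply/eqP; rewrite -dot_eq0 dotE.
have : v *m (A *m A^T) = 0 by apply/sub_kermxP; exact: row_sub.
by rewrite trmx_mul mulmxA => vAA; rewrite mulmxA vAA mul0mx mxE.
Qed.

(** All elements have natural coordinates, which gives positivity; their differences have integer
    coordinates, which gives discreteness. *)
Lemma nat_rows_positive_affine r l (C : 'M[nat]_(r, l)) :
  positive_affine_semigroup
    (nat_span (fun p => row p (map_mx (fun q => q%:R) C) : 'rV[R]_l)).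
Proof.
set G := nat_span _.
have GN x : G x -> forall j, x 0 j \is a Num.nat.
  move=> [c ->] j; rewrite summxE; apply: rpred_sum => p _.
  by rewrite mulrn_mxE !mxE rpredMn ?natr_nat.
split; last first.
  move=> x /GN x0 /GN x1; apply/rowP => j; apply/eqP; rewrite mxE eq_le.
  by have /natr_ge0 := x1 j; rewrite mxE oppr_ge0 natr_ge0 ?x0// andbT.
split; first by exists r, (fun p => row p (map_mx (fun q => q%:R) C)).
have DZ z : difference_group G z -> forall j, z 0 j \is a Num.int.
  by move=> [x [y [/GN Gx /GN Gy ->]]] j; rewrite !mxE rpredB ?intr_nat.
move=> z Gz; split; first exact/mem_set.
(* Balls of matrices are taken entrywise, so integer points in this ball differ from [z] by less
   than 1 in each coordinate. *)
exists (ball z 1); first exact: nbhsx_ballx.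
apply/seteqP; split => [x [[_ zx] Gx]|_ ->]; last by split => //; exact: ballxx.
apply/rowP => j; apply/eqP; rewrite -subr_eq0; apply/eqP/int_norm_lt1.
  by rewrite rpredB ?DZ.
by rewrite distrC; exact: zx.
Qed.

(** With the [b j] as rows of M, the map x |-> x M^T lists the pairings <x, b_j>, and its adjoint is
    y |-> y M = sum_j y_j b_j. *)
Lemma nat_factorization_is_lift n (G : set 'rV[R]_n)
    k l r (B : 'M[nat]_(r, k)) (C : 'M[nat]_(r, l))
    (a : 'I_k -> 'rV[R]_n) (b : 'I_l -> 'rV[R]_n) :
  nat_span a = G -> nat_span b = dual G ->
  (forall i j, ((B^T *m C) i j)%:R = dot (a i) (b j)) ->
  is_lift G (nat_span (fun p => row p (map_mx (fun q => q%:R) C)))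
    (fun x => x *m (\matrix_j b j)^T).
Proof.
move=> aG bG Sab.
set CR := map_mx _ C; set G' := nat_span _; set M := \matrix_j b j.
have bspan j : real_span G (b j).
  have : dual G (b j) by rewrite -bG; exact: nat_span_gen.
  by case.
have Mspan y : real_span G (y *m M).
  rewrite mulmx_sum_row; apply: real_span_sum => j.
  by rewrite rowK; exact: real_spanZ.
have iotaG x : G x -> G' (x *m M^T).
  rewrite -aG => [[c ->]].
  (* The image of [a i] is row i of B^T C, that is, the combination of the rows of C with
     coefficients [B p i]. *)
  exists (fun p => \sum_i c i * B p i)%N.
  apply/rowP => j; rewrite mulmx_suml !summxE.
  transitivity (\sum_i \sum_p CR p j *+ (c i * B p i)%N).
    apply: eq_bigr => i _.
    rewrite -scaler_nat -scalemxAl mxE mulr_natl -dot_row rowK -Sab mxE.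
    rewrite natr_sum -sumrMnl; apply: eq_bigr => p _.
    by rewrite !mxE natrM mulr_natl mulnC mulrnA.
  rewrite exchange_big; apply: eq_bigr => p _.
  by rewrite mulrn_mxE !mxE -sumrMnr.
split; first exact: nat_rows_positive_affine.
  by split => // x y _ _; rewrite mulmxDl.
exists (fun y => y *m M).
have adjE x y : dot x (y *m M) = dot (x *m M^T) y by rewrite dot_mulmx.
split.
  move=> y [_ yN]; split => [|x Gx]; last exact: adjE.
  by split => // x Gx; rewrite dotC adjE dotC; exact/yN/iotaG.
apply/seteqP; split => [_ [y [_ yN] <-]|w Gw].
  by split => // x Gx; rewrite dotC adjE dotC; exact/yN/iotaG.
(* The coefficient vector [y0] of [w] need not lie in the span of [G'], so it is
   projected orthogonally to that span; this preserves its pairings with [G']. *)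
have [c wE] : nat_span b w by rewrite bG.
pose y0 : 'rV[R]_l := \row_j (c j)%:R.
have y0M : y0 *m M = w.
  rewrite mulmx_sum_row wE; apply: eq_bigr => j _.
  by rewrite rowK mxE scaler_nat.
(* The normal equations u CR CR^T = y0 CR^T are solvable; [u *m CR] is the projection of [y0] to the
   row space of [CR]. *)
have /submxP[u uE] : (y0 *m CR^T <= CR *m CR^T)%MS.
  by apply: submx_trans (submx_mul_tr CR); exact: submxMl.
have proj x : G' x -> dot x (u *m CR) = dot x y0.
  move=> [d ->]; rewrite !dot_suml; apply: eq_bigr => p _.
  rewrite -scaler_nat !dotZl; congr (_ * _); rewrite dotC [RHS]dotC.
  by rewrite !dot_row -mulmxA uE.
have dual_proj : dual G' (u *m CR).
  split.
    rewrite mulmx_sum_row; apply: real_span_sum => p; apply: real_spanZ.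
    exists [:: row p CR]; split; last by rewrite memv_span ?mem_head.
    by move=> v; rewrite inE => /eqP ->; exact: nat_span_gen.
  (* The pairing with [x] equals that of [y0], and both [x] and [y0] have natural coordinates. *)
  move=> x G'x; rewrite dotC proj// dotC dotE mxE; apply: rpred_sum => j _.
  rewrite !mxE rpredM ?natr_nat//.
  by move: G'x => [d ->]; rewrite summxE rpred_sum// => p _;
    rewrite mulrn_mxE !mxE rpredMn ?natr_nat.
(* [u *m CR] and [y0] have the same image under the adjoint: both images lie in the span of [G] and
   pair equally with [G]. *)
exists (u *m CR) => //; rewrite -y0M; apply: (@real_span_inj _ G) => // x Gx.
by rewrite !adjE proj//; exact: iotaG.
Qed.

End Lifts.

Theorem theorem4p6 (R : realType) (n : nat) (G : set 'rV[R]_n)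
  (hG : positive_affine_semigroup G)
  (k l : nat) (S : 'M[nat]_(k, l)) (hS : slack_matrix G S) :
  has_lift_of_size G (nonneg_int_rank S) /\
  (forall r : nat, has_lift_of_size G r -> (nonneg_int_rank S <= r)%N).
Proof.
rewrite /nonneg_int_rank; case: ex_minnP => r /asboolP[B [C SBC]] rmin.
split; last first.
  move=> r' [m [G' [iota [lift [g [_ gG' _]]]]]].
  by apply/rmin/asboolP; exact: lift_nat_factorization lift gG'.
have [a [b [[_ aG _] [_ bG _] Sab]]] := hS.
rewrite SBC in Sab.
have lift := nat_factorization_is_lift aG bG Sab.
have [r' r'r [g gmin]] :=
  minimal_generators_ex (fun p => row p (map_mx (fun q => q%:R%R : R) C)).
have [_ gspan _] := gmin.
have rr' : (r <= r')%N.
  by apply/rmin/asboolP; exact: lift_nat_factorization lift gspan.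
have <- : r' = r by apply/eqP; rewrite eqn_leq r'r.
do 3 eexists; split; first exact: lift.
by exists g.
Qed.
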